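(* Assume that $\mathrm{MA(countable)}$ holds. Then there exists a $\mathrm{P}$-point $\mathcal{U}\subseteq 2^\omega$ such that $A\cap\mathcal{U}$ has the perfect set property whenever $A$ is an analytic subset of $2^\omega$.
   Context: Every subset of $\omega$ is identified with its characteristic function, so an ultrafilter on $\omega$ is regarded as a subset of the Cantor set $2^\omega$. For $x,y\subseteq\omega$, $x\subseteq^\ast y$ means that $x\setminus y$ is finite; a pseudointersection of $\mathcal{C}\subseteq\mathcal{P}(\omega)$ is a set $x\subseteq\omega$ such that $x\subseteq^\ast y$ for all $y\in\mathcal{C}$. A $\mathrm{P}$-point is a non-principal ultrafilter $\mathcal{U}$ on $\omega$ such that every countable $\mathcal{C}\subseteq\mathcal{U}$ has a pseudointersection in $\mathcal{U}$. A perfect set in $2^\omega$ is a non-empty closed subset of $2^\omega$ with no isolated points. A set $B\subseteq 2^\omega$ has the perfect set property if $B$ is either countable or contains a perfect set in $2^\omega$. $\mathrm{MA(countable)}$ (Martin's Axiom for countable posets) is the statement: for every non-empty countable partially ordered set $\mathbb{P}$ and every collection $\mathcal{D}$ of dense subsets of $\mathbb{P}$ with $|\mathcal{D}|<\mathfrak{c}=2^{\aleph_0}$, there is a filter $G\subseteq\mathbb{P}$ that meets every element of $\mathcal{D}$. *)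

(* Defs.v *)
From HB Require Import structures.
From mathcomp Require Import all_boot all_order all_algebra.
From mathcomp Require Import all_classical all_reals topology cantor.

Set Implicit Arguments.
Unset Strict Implicit.
Unset Printing Implicit Defensive.

Import Order.TTheory.

Local Open Scope classical_set_scope.
Local Open Scope card_scope.
Local Open Scope order_scope.

Definition card_lt (T U : Type) (A : set T) (B : set U) : Prop :=
  A #<= B /\ A #!= B.

(* Order convention of forcing: smaller elements are stronger conditions. *)
Definition order_dense (d : Order.disp_t) (P : porderType d) (E : set P) :=
  forall p : P, exists2 q, E q & q <= p.

Definition order_filter (d : Order.disp_t) (P : porderType d) (G : set P) :=
  [/\ G !=set0,
      forall p q, G p -> p <= q -> G q &
      forall p q, G p -> G q -> exists r, [/\ G r, r <= p & r <= q]].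

(* The continuum is the cardinality of [cantor_space], i.e. of nat -> bool. *)
Definition MA_countable : Prop :=
  forall (d : Order.disp_t) (P : porderType d),
    [set: P] !=set0 -> countable [set: P] ->
  forall D : set (set P),
    (forall E, D E -> order_dense E) ->
    card_lt D [set: cantor_space] ->
  exists G : set P, order_filter G /\ (forall E, D E -> G `&` E !=set0).

Definition almost_subset (x y : set nat) : Prop := finite_set (x `\` y).

Definition pseudointersection (C : set (set nat)) (x : set nat) : Prop :=
  forall y, C y -> almost_subset x y.

Definition P_point (U : set_system nat) : Prop :=
  [/\ UltraFilter U,
      forall n : nat, U <> principal_filter n &
      forall C : set (set nat), countable C -> C `<=` U ->
        exists2 x, U x & pseudointersection C x].

(* A family of subsets of nat, seen as a subset of 2^nat by identifying every
   set with its characteristic function. *)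
Definition to_cantor (U : set_system nat) : set cantor_space :=
  [set x : cantor_space | U [set n | x n]].

(* [perfect_set] of the library allows the empty set. *)
Definition perfect_set_property (T : topologicalType) (B : set T) : Prop :=
  countable B \/ exists K : set T, [/\ K !=set0, perfect_set K & K `<=` B].

(* The types [completeType] and [completePseudoMetricType] of the library are
   pointed; separability and completeness are predicates here so that the
   empty space counts as Polish, hence the empty set as analytic. *)
Definition separable (T : topologicalType) : Prop :=
  exists2 S : set T, countable S & dense S.

Definition complete (T : uniformType) : Prop :=
  forall F : set_system T, ProperFilter F -> cauchy F ->
    exists l : T, F --> l.

(* A is a continuous image of a Polish space, the latter being presented with a
   compatible complete metric. *)
Definition analytic (R : realType) (T : topologicalType) (A : set T) : Prop :=
  exists (Y : metricType R) (f : Y -> T),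
    [/\ complete Y, separable Y, continuous f & range f = A].

(* Main.v *)
Require Import Defs.
From HB Require Import structures.
From mathcomp Require Import all_boot all_order all_algebra.
From mathcomp Require Import all_classical all_reals topology cantor.
From mathcomp Require wochoice.

(** Write c for the continuum.  The P-point U is generated by sets x_i, i < c,
    built by recursion so that at every stage the filter F_i generated by the
    earlier sets and the final segments of nat has fewer than c generators.

    Each stage i is devoted to one of c many requests ([task]): either a
    sequence of sets, for which a pseudointersection is wanted, or a tree T on
    nat * bool, for which the wanted set x is contained in every member of some
    perfect subset of the projection of T.  If some x compatible with F_i grants
    the request, then x_i is such an x; otherwise nothing is added.  Since every
    analytic set is the projection of a tree ([analytic_projection]), U is as
    required once the following is known: whenever the final U satisfies the
    premise of a request (it contains the whole sequence; it meets the
    projection of T in an uncountable set), stage i could grant it.  This is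
    where Martin's Axiom enters, in the form of two lemmas on a filter U and a
    family Z of fewer than c members of U:
    - [pseudointersection_meeting]: every sequence in U has a
      pseudointersection that meets all members of Z;
    - [perfect_meeting]: if the projection of T meets U in an uncountable set,
      then some x meets all members of Z and lies below all members of a perfect
      subset of the projection.
    A constant request y decides y: either y itself meets all of F_i, and then a
    set almost contained in y is in U, or some member of F_i misses y.

    For the second lemma, discard the branches of T that lie, from some point
    on, in a thin part; what remains is a set E of branches with projections in
    U that is crowded, also after projection ([crowded_kernel]).  A condition is
    a finite family of finite pieces of members of E, all of the same length.
    A generic sequence of conditions gives a perfect set by fusion, and x is the
    intersection of this perfect set.  It meets z in Z by density: the finitely
    many members of E that extend a condition all have projections in U, so that
    they share an element of z, which can be decided to belong to x.

    The recursion needs a well-order of a set of size c where an initial segment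
    W not only has size less than c, but has fewer than c finite sequences,
    because these index the finite intersections from F_i.  Instead of proving
    that k * k = k for infinite cardinals, [short_well_order] reorders the set
    so that this holds. *)

Set Implicit Arguments.
Unset Strict Implicit.
Unset Printing Implicit Defensive.

Import Order.TTheory GRing.Theory Num.Theory.
Local Open Scope classical_set_scope.

(** * Cardinality and generic sequences *)

(** Stated without a bound from above, so that it passes to images and along
    injections without any comparability of cardinals; [card_lt] follows for the
    families that matter, as they consist of sets of natural numbers. *)
Definition below_continuum T (W : set T) : Prop :=
  ~ ([set: cantor_space] #<= W)%card.

Lemma card_le_inj T U (A : set T) (B : set U) (f : T -> U) :
  set_fun A B f -> set_inj A f -> (A #<= B)%card.
Proof.
by move=> fAB finj; have /injfunPex[g] : exists2 f : T -> U, set_fun A B f & set_inj A f;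
  [exists f | exact: inj_card_le].
Qed.

Lemma card_le_injP T U (u0 : U) (A : set T) (B : set U) :
  (A #<= B)%card -> exists2 f : T -> U, set_fun A B f & set_inj A f.
Proof.
elim/Ppointed: U => U in B u0 *; first by case: (no u0).
by move=> /pcard_leP; move/injfunPex.
Qed.

Lemma below_continuum_le T U (A : set T) (B : set U) :
  (A #<= B)%card -> below_continuum B -> below_continuum A.
Proof. by move=> AB nB cA; apply: nB; exact: card_le_trans AB. Qed.

Lemma card_le_cantor_countType (K : countType) T (f : T -> K -> Prop) :
  injective f -> ([set: T] #<= [set: cantor_space])%card.
Proof.
move=> finj.
pose g t : cantor_space := fun n => if unpickle n is Some k then `[< f t k >] else false.
apply: (@card_le_inj _ _ _ _ g) => // t u _ _ gtu.
apply/finj/funext => k; apply/propext.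
have /(congr1 (fun h => h (pickle k))) := gtu; rewrite /g pickleK => e.
by split=> [/asboolP|/asboolP]; [rewrite e|rewrite -e] => /asboolP.
Qed.

Lemma card_set_nat_le_cantor : ([set: set nat] #<= [set: cantor_space])%card.
Proof. exact: (@card_le_cantor_countType nat _ (fun z => z)). Qed.

(** Martin's Axiom for a countable preorder, with the filter replaced by a
    descending sequence: a countable directed set has a cofinal sequence.  The
    axiom is about partial orders; the reflexive closure of the strict part of
    the preorder is one, and downward closures of dense sets stay dense in it. *)
Lemma generic_chain (hMA : MA_countable) (S : countType) (le : S -> S -> Prop)
    (Z : set (set nat)) (D : set nat -> set S) (s0 : S) :
  (forall p, le p p) -> (forall p q r, le p q -> le q r -> le p r) ->
  below_continuum Z ->
  (forall z, Z z -> forall p, exists q, D z q /\ le q p) ->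
  exists g : nat -> S, (forall k, le (g k.+1) (g k)) /\
    forall z, Z z -> exists k e, D z e /\ le (g k) e.
Proof.
move=> lexx letr Zsm Dd.
pose sle (p q : S) : bool := `[< p = q \/ (le p q /\ ~ le q p) >].
have slexx : reflexive sle by move=> p; apply/asboolP; left.
have slea : antisymmetric sle.
  by move=> p q /andP[/asboolP[//|[_ h]] /asboolP[//|[]]].
have sletr : transitive sle.
  move=> q p r /asboolP[-> //|[pq qp]] /asboolP[<-|[qr rq]]; apply/asboolP; right=> //.
  split; first exact: letr qr.
  by move=> rp; apply: qp; exact: letr rp.
have sleW p q : sle p q -> le p q by move=> /asboolP[->|[]].
pose P : porderType Order.default_display :=
  HB.pack S (Order.Le_isPOrder.Build Order.default_display S slexx slea sletr).
have PleE (p q : P) : (p <= q)%O -> le p q by exact: sleW.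
(* Downward closed, hence dense in the strict order: if p lies above an element
   e of D z but not strictly, then p itself is below e. *)
pose E z : set P := [set q : P | exists2 e : S, D z e & le q e].
have Pne : [set: P] !=set0 by exists s0.
have Pctb : countable [set: P] by exact: (@countableP S).
have [||G [[[p0 Gp0] Gup Gdir] GE]] := hMA _ P Pne Pctb (E @` Z).
- move=> _ [z Zz <-] p; have [e [De ep]] := Dd _ Zz p.
  have [pe|npe] := pselect (le p e).
    by exists p; [exists e | exact: slexx].
  by exists e; [exists e | apply/asboolP; right].
- have EZ : (E @` Z #<= Z)%card by exact: card_image_le.
  split.
    apply: card_le_trans EZ _; apply: card_le_trans card_set_nat_le_cantor.
    exact: card_leT.
  apply/negP => /card_eqPle[_ h]; apply: Zsm; exact: card_le_trans EZ.
have /boolp.choice[h hP] : forall pk : S * nat, exists r : S, G pk.1 ->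
    [/\ G r, le r pk.1 &
     forall q, unpickle pk.2 = Some q -> G q -> le r q].
  move=> [p k] /=.
  have [Gp|nGp] := pselect (G p); last by exists p => /nGp.
  have [[q [qk Gq]]|nq] := pselect (exists q, unpickle k = Some q /\ G q).
    have [r [Gr rp rq]] := Gdir _ _ Gp Gq; exists r => _.
    split=> // [|q']; first exact: PleE.
    by rewrite qk => -[<-] _; exact: PleE.
  by exists p => _; split=> // q kq Gq; case: nq; exists q.
pose g := fix g k := if k is k.+1 then h (g k, k) else p0.
have gG k : G (g k) by elim: k => //= k IH; have [] := hP (g k, k) IH.
exists g; split=> [k|z Zz]; first by have [] := hP (g k, k) (gG k).
have [|q [Gq [e De qe]]] := GE (E z); first by exists z.
exists (pickle (q : S)).+1, e; split=> //; apply: letr qe => /=.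
have [_ _] := hP (g (pickle (q : S)), pickle (q : S)) (gG _).
by apply=> //; exact: pickleK.
Qed.

(** * Pseudointersections *)

Lemma filter_seqI (I : eqType) (T : Type) (U : set_system T) (FU : Filter U)
    (s : seq I) (W : I -> set T) :
  (forall i, i \in s -> U (W i)) -> U [set t | forall i, i \in s -> W i t].
Proof.
elim: s => [_|i s IH Us]; first by apply: filterS filterT.
have Ui : U (W i) by apply: Us; rewrite mem_head.
have Us' : U [set t | forall i, i \in s -> W i t].
  by apply: IH => j js; apply: Us; rewrite inE js orbT.
apply: filterS (filterI Ui Us') => t [Wi Ws] j; rewrite inE => /orP[/eqP->//|].
exact: Ws.
Qed.

(** A condition (n, s) promises that x contains s and that every later element
    lies in y 0, ..., y (n - 1). *)
Lemma pseudointersection_meeting (hMA : MA_countable) (U : set_system nat)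
    (Z : set (set nat)) (y : nat -> set nat) :
  ProperFilter U -> Z `<=` U -> below_continuum Z ->
  (forall N, Z [set m | N <= m]) -> (forall n, U (y n)) ->
  exists x : set nat, (forall z, Z z -> x `&` z !=set0) /\
    forall n, almost_subset x (y n).
Proof.
move=> PU ZU Zsm Ztail Uy.
pose le (q p : nat * seq nat) := p.1 <= q.1 /\
  exists2 u, q.2 = p.2 ++ u & forall m i, m \in u -> i < p.1 -> y i m.
pose D (z : set nat) : set (nat * seq nat) :=
  [set p | exists m, [/\ z m, m \in p.2 & m <= p.1]].
have lexx p : le p p by split=> //; exists [::]; rewrite ?cats0.
have letr p q r : le p q -> le q r -> le p r.
  move=> [qp [u pu uy]] [rq [v qv vy]]; split; first exact: leq_trans qp.
  exists (v ++ u); first by rewrite pu qv catA.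
  move=> m i; rewrite mem_cat => /orP[|] mu ir; first exact: vy.
  by apply: uy => //; exact: leq_trans rq.
have [z Zz p|g [gle gD]] := @generic_chain hMA _ le Z D (0, [::]) lexx letr Zsm.
  have Uyp : U [set m | forall i, i \in iota 0 p.1 -> y i m].
    by apply: filter_seqI => i _; exact: Uy.
  have [m [ym zm]] := filter_ex (filterI Uyp (ZU _ Zz)).
  exists (p.1 + m, rcons p.2 m); split.
    by exists m; split; rewrite //= ?mem_rcons ?mem_head ?leq_addl.
  split; first exact: leq_addr.
  exists [:: m] => [|m' i]; first by rewrite /= cats1.
  by rewrite inE => /eqP-> ip; apply: ym; rewrite mem_iota.
have gmon k k' : k <= k' -> le (g k') (g k).
  by move=> /subnK <-; elim: (k' - k) => [|j IH]; [exact: lexx | exact: (letr _ _ _ (gle _) IH)].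
have gmem k k' : k <= k' -> {subset (g k).2 <= (g k').2}.
  by move=> /gmon[_ [u -> _]] m mk; rewrite mem_cat mk.
exists [set m | exists k, m \in (g k).2]; split=> [z /gD[k [e [De [_ [u gu _]]]]]|n].
  have [m [zm me _]] := De.
  by exists m; split=> //; exists k; rewrite gu mem_cat me.
have [k [e [[m [/= nm _ me]] [ek _]]]] := gD _ (Ztail n.+1).
apply: (@sub_finite_set _ _ [set` (g k).2]); last exact: finite_seq.
move=> j [[k' jk'] nyj] /=; have [k'k|kk'] := leqP k' k; first exact: gmem jk'.
have [_ [u gu uy]] := gmon _ _ (ltnW kk'); move: jk'; rewrite gu mem_cat => /orP[//|ju].
by case: nyj; apply: uy ju _; exact: leq_trans nm (leq_trans me ek).
Qed.

(** * Trees and crowded sets of branches *)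

Local Notation node := (seq (nat * bool)).
Local Notation branch := (nat -> nat * bool).

Definition proj2nd (b : branch) : cantor_space := fun n => (b n).2.

(** [projection T] is the set p[T] of descriptive set theory: a node carries
    a finite piece of a point of the Baire space together with a finite piece of
    a point of the Cantor space. *)
Definition projection (T : set node) : set cantor_space :=
  proj2nd @` [set b | forall n, T (mkseq b n)].

Lemma take_mkseq A (b : nat -> A) l m : l <= m -> take l (mkseq b m) = mkseq b l.
Proof. by move=> lm; rewrite /mkseq -map_take take_iota (minn_idPl lm). Qed.

Lemma mkseq_eqP A (b c : nat -> A) n :
  mkseq b n = mkseq c n <-> forall i, i < n -> b i = c i.
Proof.
split=> [bc i ni|bc]; last by apply/eq_in_map => i; rewrite mem_iota => /bc.
by rewrite -(nth_mkseq (b 0) b ni) bc nth_mkseq.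
Qed.

Definition crowded (E : set branch) := forall b, E b -> forall n,
  exists c, [/\ E c, mkseq c n = mkseq b n & proj2nd c <> proj2nd b].

(** The argument of the Cantor-Bendixson theorem: there are only countably many
    nodes, so the cones with countable projection can be removed together.
    Working with projections avoids choosing branches on which the projection is
    injective. *)
Lemma crowded_kernel (B : set branch) : ~ countable (proj2nd @` B) ->
  exists E : set branch, [/\ E `<=` B, E !=set0 & crowded E].
Proof.
move=> Bunc.
pose cone (s : node) : set branch := [set b | B b /\ mkseq b (size s) = s].
pose thin (s : node) := countable (proj2nd @` cone s).
pose E := [set b | B b /\ forall n, ~ thin (mkseq b n)].
have thinc : countable (\bigcup_(s in thin) (proj2nd @` cone s)) by apply: bigcup_countable.
have fat s v : ~ thin s -> exists b, [/\ E b, mkseq b (size s) = s & proj2nd b <> v].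
  move=> sfat; apply: contrapT => nb; apply: sfat.
  apply: (@sub_countable _ _ _ (\bigcup_(s in thin) (proj2nd @` cone s) `|` [set v])).
    apply: subset_card_le => _ [b [Bb bs] <-].
    have [->|bv] := pselect (proj2nd b = v); [by right | left].
    have [[n bn]|nthin] := pselect (exists n, thin (mkseq b n)).
      by exists (mkseq b n) => //; exists b => //; split; rewrite ?size_mkseq.
    case: nb; exists b; split=> //; split=> // n bn; apply: nthin; by exists n.
  rewrite -bigcup2E; apply: bigcup_countable => // -[|[|i]] _ //=; exact: countable1.
exists E; split=> [b []//||b [Bb bfat] n].
  have [|b [Eb _ _]] := fat [::] point; last by exists b.
  apply: contra_not Bunc; apply: sub_countable; apply: subset_card_le.
  by move=> _ [b Bb <-]; exists b.
have [c] := fat _ (proj2nd b) (bfat n).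
by rewrite size_mkseq => -[]; exists c.
Qed.

(** * Finite approximations of a perfect set *)

(** A pair (l, L) stands for the union of the cylinders over the projections of
    the nodes of L, all of length l.  By injectivity of the projection on L, a
    point of this union determines the node that it comes from. *)
Definition approximation (E : set branch) (p : nat * seq node) : Prop :=
  [/\ p.2 != [::],
      forall s, s \in p.2 -> exists2 b, E b & mkseq b p.1 = s &
      {in p.2 &, injective (map snd)}].

Definition refines (q p : nat * seq node) : Prop :=
  p.1 <= q.1 /\ p.2 =i map (take p.1) q.2.

(** Besides putting an element m of z in the future intersection, every node is
    split above level m; as the final segments are among the sets z, this alone
    makes the limit perfect and the lengths unbounded. *)
Definition splits_at (z : set nat) (p : nat * seq node) : Prop :=
  exists m, [/\ z m, m < p.1 & forall s, s \in p.2 ->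
    (nth (0, false) s m).2 /\
    exists t, [/\ t \in p.2, t <> s & take m t = take m s]].

Lemma approximation_size E p s : approximation E p -> s \in p.2 -> size s = p.1.
Proof. by move=> [_ pE _] /pE[b _ <-]; rewrite size_mkseq. Qed.

Lemma refines_refl E p : approximation E p -> refines p p.
Proof.
move=> pE; split=> // s; apply/idP/mapP => [sp|[t tp ->]].
  by exists s; rewrite // take_oversize // (approximation_size pE sp).
by rewrite take_oversize // (approximation_size pE tp).
Qed.

Lemma refines_trans p q r : refines p q -> refines q r -> refines p r.
Proof.
move=> [qp pq] [rq qr]; split=> [|s]; first exact: leq_trans qp.
rewrite qr; apply/mapP/mapP => [[t]|[t tp ->]].
  by rewrite pq => /mapP[u up ->] ->; exists u => //; rewrite take_takel.
by exists (take q.1 t); [rewrite pq; exact: map_f | rewrite take_takel].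
Qed.

(** Above each node s choose a branch c s in E, then an m in z common to their
    projections, and only then a second branch d s that agrees with c s up to
    and including m, so that its projection contains m as well. *)
Lemma splits_at_dense (U : set_system nat) (E : set branch) (z : set nat) p :
  ProperFilter U -> E `<=` [set b | to_cantor U (proj2nd b)] -> crowded E ->
  U z -> (forall N, U [set m | N <= m]) -> approximation E p ->
  exists q, [/\ approximation E q, splits_at z q & refines q p].
Proof.
move=> PU EU Ecr Uz Utail pE; have [p0 pb pinj] := pE.
have /boolp.choice[c cP] : forall s, exists b, s \in p.2 -> E b /\ mkseq b p.1 = s.
  move=> s; have [/pb[b Eb bs]|_] := boolP (s \in p.2); first by exists b.
  by exists point.
have Uc : U [set m | forall s, s \in p.2 -> (c s m).2].
  apply: (@filter_seqI _ _ _ _ _ (fun s => [set m | (c s m).2])) => s /cP[Ecs _].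
  exact: EU Ecs.
have [m [[/= cm lm] zm]] := filter_ex (filterI (filterI Uc (Utail p.1)) Uz).
have /boolp.choice[d dP] : forall s, exists b, s \in p.2 ->
    [/\ E b, mkseq b m.+1 = mkseq (c s) m.+1 & exists j, (b j).2 <> (c s j).2].
  move=> s; have [/cP[Ecs _]|_] := boolP (s \in p.2); last by exists point.
  have [b [Eb bm bc]] := Ecr _ Ecs m.+1; exists b => _; split=> //.
  by apply: contra_notP bc => nj; apply: funext => j; apply: contrapT => bj; apply: nj; exists j.
have /boolp.choice[j jP] : forall s, exists j, s \in p.2 -> (d s j).2 <> (c s j).2.
  by move=> s; have [/dP[_ _ [j jP]]|_] := boolP (s \in p.2); [exists j | exists 0].
(* Long enough for c s and d s to have different projections below M. *)
pose M := (m + \max_(s <- p.2) j s).+1.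
have jM s : s \in p.2 -> j s < M.
  by move=> sp; rewrite ltnS; apply: leq_trans (leq_addl _ _); exact: leq_bigmax_seq.
have mM : m < M by rewrite ltnS leq_addr.
pose L := [seq mkseq (c s) M | s <- p.2] ++ [seq mkseq (d s) M | s <- p.2].
have LP t : t \in L -> exists s f, [/\ s \in p.2, f = c s \/ f = d s & t = mkseq f M].
  rewrite mem_cat => /orP[] /mapP[s sp ->]; first by exists s, (c s); split=> //; left.
  by exists s, (d s); split=> //; right.
have Lc s : s \in p.2 -> mkseq (c s) M \in L.
  by move=> sp; rewrite mem_cat (map_f (fun s => mkseq (c s) M) sp).
have Ld s : s \in p.2 -> mkseq (d s) M \in L.
  by move=> sp; rewrite mem_cat (map_f (fun s => mkseq (d s) M) sp) orbT.
have Ef s f : s \in p.2 -> f = c s \/ f = d s -> [/\ E f, mkseq f p.1 = s & (f m).2].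
  move=> sp; have [Ec cs] := cP _ sp; have [Ed /mkseq_eqP dc _] := dP _ sp.
  move=> [->|->]; split=> //; first exact: cm.
    apply: etrans cs; apply/mkseq_eqP => i ip; apply: dc.
    by apply: leq_trans ip (leq_trans lm (leqnSn m)).
  by rewrite dc //; exact: cm.
have sep s : s \in p.2 -> mkseq (snd \o d s) M <> mkseq (snd \o c s) M.
  by move=> sp /mkseq_eqP/(_ (j s) (jM _ sp)); exact: jP.
have lM : p.1 <= M by apply: leq_trans lm (ltnW mM).
exists (M, L); split.
- split=> /=.
  + by rewrite /L; case: p.2 p0.
  + by move=> t /LP[s [f [sp /(Ef _ _ sp)[Ef' _ _] ->]]]; exists f.
  + move=> t t' /LP[s [f [sp sf ->]]] /LP[s' [f' [sp' sf' ->]]].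
    rewrite /mkseq -!map_comp -!/(mkseq _ _) => ff'.
    have [_ fs _] := Ef _ _ sp sf; have [_ fs' _] := Ef _ _ sp' sf'.
    have ss' : s = s'.
      apply: pinj => //; rewrite -fs -fs' /mkseq -!map_comp -!/(mkseq _ _).
      by rewrite -!(take_mkseq _ lM) ff'.
    rewrite -ss' in sf' *; case: sf ff' => ->; case: sf' => -> //.
      by move=> ff'; case: (sep _ sp); exact: esym ff'.
    by move=> ff'; case: (sep _ sp).
- exists m; split=> // t /LP[s [f [sp sf ->]]]; split.
    by rewrite nth_mkseq //; have [] := Ef _ _ sp sf.
  have [_ /mkseq_eqP dc _] := dP _ sp.
  have cdm : mkseq (d s) m = mkseq (c s) m.
    by apply/mkseq_eqP => i im; apply: dc; exact: leqW.
  have sep' := sep _ sp.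
  case: sf => ->; [exists (mkseq (d s) M) | exists (mkseq (c s) M)].
    split; rewrite ?Ld // ?take_mkseq ?(ltnW mM) //.
    by move=> /(congr1 (map snd)); rewrite /mkseq -!map_comp.
  split; rewrite ?Lc // ?take_mkseq ?(ltnW mM) //.
  by move=> /(congr1 (map snd)); rewrite /mkseq -!map_comp => /esym.
- split=> // s; apply/idP/mapP => [sp|[t /LP[s' [f [sp sf ->]]] ->]].
    exists (mkseq (c s) M); first exact: Lc.
    by rewrite take_mkseq //; have [_ ->] := cP _ sp.
  by rewrite take_mkseq //; have [_ -> _] := Ef _ _ sp sf.
Qed.

Lemma approximation_chain (hMA : MA_countable) (U : set_system nat)
    (Z : set (set nat)) (E : set branch) :
  ProperFilter U -> Z `<=` U -> below_continuum Z ->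
  (forall N, U [set m | N <= m]) ->
  E !=set0 -> E `<=` [set b | to_cantor U (proj2nd b)] -> crowded E ->
  exists p : nat -> nat * seq node,
    [/\ forall k, approximation E (p k), forall k, refines (p k.+1) (p k) &
     forall z, Z z -> exists k e, [/\ approximation E e, splits_at z e & refines (p k) e]].
Proof.
move=> PU ZU Zsm Utail [b0 Eb0] EU Ecr.
pose S := {p : nat * seq node | `[< approximation E p >]}.
have SE (p : S) : approximation E (val p) by case: p => p /= /asboolP.
have rootE : `[< approximation E (0, [:: [::]]) >].
  apply/asboolP; split=> // [s|s t]; first by rewrite inE => /eqP->; exists b0.
  by rewrite !inE => /eqP-> /eqP->.
pose root : S := Sub (0, [:: [::]]) rootE.
have lexx (p : S) : refines (val p) (val p) by apply: refines_refl (SE p).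
have letr (p q r : S) : refines (val p) (val q) -> refines (val q) (val r) ->
  refines (val p) (val r) by exact: refines_trans.
have [z Zz p|g [gle gD]] := generic_chain hMA (D := fun z (p : S) => splits_at z (val p))
  root lexx letr Zsm.
  have [q [/asboolP qE qz qp]] := splits_at_dense PU EU Ecr (ZU _ Zz) Utail (SE p).
  by exists (Sub q qE).
exists (val \o g); split=> [k|k|z /gD[k [e [ez ge]]]]; [exact: SE|exact: gle|].
by exists k, (val e).
Qed.

(** * Fusion *)

Lemma cylinder_nbhs (x : cantor_space) n :
  nbhs x [set y : cantor_space | mkseq y n = mkseq x n].
Proof.
have : nbhs x [set y : cantor_space | forall i, i \in iota 0 n -> y i = x i].
  apply: (@filter_seqI _ _ _ _ _ (fun i => [set y : cantor_space | y i = x i])) => i _.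
  apply: (@proj_continuous nat (fun=> bool) i x [set b | b = x i]).
  by apply: open_nbhs_nbhs; split=> //; exact: discrete_open.
by apply: filterS => y xy; apply/mkseq_eqP => i ni; apply: xy; rewrite mem_iota.
Qed.

(** This describes neighbourhoods from the inside: a neighbourhood of x contains
    all points that agree with x long enough. *)
Lemma cvg_cantor (u : nat -> cantor_space) (x : cantor_space) :
  (forall n, mkseq (u n) n = mkseq x n) -> u n @[n --> \oo] --> x.
Proof.
move=> ux; apply/cvg_sup => i; apply/cvg_image.
  by rewrite -subTset => b _; exists (fun=> b).
move=> A Ax; exists [set y : cantor_space | A (y i)].
  exists i.+1 => // n /= ni; have /mkseq_eqP -> := ux n; last exact: ni.
  exact: nbhs_singleton Ax.
by apply/seteqP; split=> [_ [y Ay <-] //|b Ab]; exists (fun=> b).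
Qed.

Lemma perfect_cantorP (K : set cantor_space) :
  (forall x, (forall n, exists2 y, K y & mkseq y n = mkseq x n) -> K x) ->
  (forall x, K x -> forall n, exists y, [/\ K y, y <> x & mkseq y n = mkseq x n]) ->
  perfect_set K.
Proof.
move=> Kcl Kcr; have cK : closed K.
  move=> x clx; apply: Kcl => n.
  by have [y [Ky yx]] := clx _ (cylinder_nbhs x n); exists y.
split=> //; apply/seteqP; split=> x.
  move=> lx; apply: Kcl => n.
  by have [y [_ Ky yx]] := lx _ (cylinder_nbhs x n); exists y.
move=> Kx W Wx; have /boolp.choice[u uP] := Kcr x Kx.
have ux : u n @[n --> \oo] --> x by apply: cvg_cantor => n; have [] := uP n.
have [n _ /(_ n (leqnn n)) Wu] := ux W Wx.
by exists (u n); have [Ku /eqP un _] := uP n.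
Qed.

Definition fusion_sequence (E : set branch) (p : nat -> nat * seq node) : Prop :=
  [/\ forall k, approximation E (p k), forall k, refines (p k.+1) (p k) &
     forall N, exists k e, [/\ approximation E e,
       splits_at [set m | N <= m] e & refines (p k) e]].

Definition fusion (p : nat -> nat * seq node) : set cantor_space :=
  [set x | forall k, mkseq x (p k).1 \in map (map snd) (p k).2].

Section Fusion.
Context (E : set branch) (p : nat -> nat * seq node) (pF : fusion_sequence E p).

Let pE k : approximation E (p k). Proof. by have [] := pF. Qed.

Lemma fusion_refines k k' : k <= k' -> refines (p k') (p k).
Proof.
have [_ pdec _] := pF.
move=> /subnK <-; elim: (k' - k) => [|j IH]; first exact: refines_refl (pE k).
exact: refines_trans (pdec _) IH.
Qed.

Lemma fusion_unbounded n : exists k, n <= (p k).1.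
Proof.
have [_ _ /(_ n)[k [e [_ [m [nm me _]] [ek _]]]]] := pF.
by exists k; apply: leq_trans nm (leq_trans (ltnW me) ek).
Qed.

Lemma fusion_leaf x k : fusion p x ->
  exists2 s, s \in (p k).2 & map snd s = mkseq x (p k).1.
Proof. by move=> /(_ k)/mapP[s sp ->]; exists s. Qed.

(** Later conditions refine earlier ones, so membership in the fusion only has
    to be tested at arbitrarily late stages. *)
Lemma fusion_later x : (forall k, exists k', k <= k' /\
  mkseq x (p k').1 \in map (map snd) (p k').2) -> fusion p x.
Proof.
move=> xk k; have [k' [/fusion_refines [ll pp] /mapP[s sp xs]]] := xk k.
apply/mapP; exists (take (p k).1 s); first by rewrite pp map_f.
by rewrite map_take -xs take_mkseq.
Qed.

(** Every node of every condition survives: follow extensions of it through the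
    later conditions and take the limit. *)
Lemma fusion_through k s : s \in (p k).2 ->
  exists2 x, fusion p x & mkseq x (p k).1 = map snd s.
Proof.
move=> sk.
have /boolp.choice[h hP] : forall jt : nat * node, exists u, jt.2 \in (p jt.1).2 ->
    u \in (p jt.1.+1).2 /\ take (p jt.1).1 u = jt.2.
  move=> [j t] /=; have [|_] := boolP (t \in (p j).2); last by exists t.
  by have [_ ->] := fusion_refines (leqnSn j); move=> /mapP[u up ->]; exists u.
pose t := fix t j := if j is j.+1 then h (k + j, t j) else s.
have tp j : t j \in (p (k + j)).2.
  by elim: j => [|j IH]; rewrite ?addn0 //= addnS; have [] := hP (k + j, t j) IH.
have tS j : take (p (k + j)).1 (t j.+1) = t j by have [] := hP (k + j, t j) (tp j).
have tt i j : take (p (k + i)).1 (t (i + j)) = t i.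
  elim: j => [|j IH]; first by rewrite addn0 take_oversize // (approximation_size (pE _) (tp i)).
  rewrite addnS -[RHS]IH -(tS (i + j)) take_takel //.
  have kk : k + i <= k + (i + j) by rewrite leq_add2l leq_addr.
  by have [] := fusion_refines kk.
have tnth a b i : i < (p (k + a)).1 -> i < (p (k + b)).1 ->
    nth (0, false) (t a) i = nth (0, false) (t b) i.
  wlog ab : a b / a <= b => [ht ia ib|ia _].
    by have [ab|/ltnW ba] := leqP a b; [exact: ht | apply/esym/ht].
  by rewrite -(tt a (b - a)) subnKC // nth_take.
have [l lP] := boolp.choice fusion_unbounded.
pose x : cantor_space := fun i => (nth (0, false) (t (l i.+1)) i).2.
have xt j : mkseq x (p (k + j)).1 = map snd (t j).
  have sz := approximation_size (pE _) (tp j).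
  apply: (@eq_from_nth _ false) => [|i]; first by rewrite size_mkseq size_map sz.
  rewrite size_mkseq => ij; rewrite nth_mkseq // (nth_map (0, false)) ?sz //.
  congr snd; have li : i < (p (k + l i.+1)).1.
    apply: leq_trans (lP i.+1) _.
    by have [] := fusion_refines (leq_addl k (l i.+1)).
  exact: tnth.
exists x; last by have := xt 0; rewrite addn0.
apply: fusion_later => k'; exists (k + k'); split; first exact: leq_addl.
by rewrite xt map_f.
Qed.

Lemma fusion_nonempty : fusion p !=set0.
Proof.
have [p0 _ _] := pE 0; have [s sp] : exists s, s \in (p 0).2.
  by case: (p 0).2 p0 => // s l _; exists s; rewrite mem_head.
by have [x px _] := fusion_through sp; exists x.
Qed.

(** Given x in the fusion, the twin of the node of x supplies a second point
    close to x; it differs from x because distinct nodes of a condition have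
    distinct projections. *)
Lemma perfect_fusion : perfect_set (fusion p).
Proof.
apply: perfect_cantorP => [x xK k|x xK n].
  by have [y /(_ k) yk <-] := xK (p k).1.
have [_ _ /(_ n)[k [e [_ [m [/= nm me msplit]] [ek pe]]]]] := pF.
have [s sk xs] := fusion_leaf k xK.
have [_ [t' [te tns tm]]] : take e.1 s \in e.2 /\ exists t', [/\ t' \in e.2, t' <> take e.1 s &
    take m t' = take m (take e.1 s)].
  have se : take e.1 s \in e.2 by rewrite pe map_f.
  by split=> //; have [] := msplit _ se.
move: te; rewrite pe => /mapP[t tk te]; subst t'.
have [y yK yt] := fusion_through tk.
have mk : m <= (p k).1 by apply: leq_trans (ltnW me) ek.
exists y; split=> // [yx|].
  have [_ _ pinj] := pE k; apply: tns; congr take.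
  by apply: pinj => //; rewrite -yt yx xs.
rewrite -(take_mkseq _ (leq_trans nm mk)) -[in RHS](take_mkseq _ (leq_trans nm mk)).
rewrite yt -xs -!map_take; congr map.
have := congr1 (take n) tm.
by rewrite !(take_takel _ nm) !take_takel // (leq_trans nm (ltnW me)).
Qed.

(** The nodes that x selects in the successive conditions are unique, hence
    coherent; their union is a branch of T. *)
Lemma fusion_sub_projection (T : set node) :
  E `<=` [set b | forall n, T (mkseq b n)] -> fusion p `<=` projection T.
Proof.
move=> ET x xK; have /boolp.choice[s sP] : forall k, exists s,
    s \in (p k).2 /\ map snd s = mkseq x (p k).1.
  by move=> k; have [s sk xs] := fusion_leaf k xK; exists s.
have ss k k' : k <= k' -> take (p k).1 (s k') = s k.
  move=> kk'; have [ll pp] := fusion_refines kk'.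
  have [_ _ pinj] := pE k; have [sk xs] := sP k; have [sk' xs'] := sP k'.
  apply: pinj => //; first by rewrite pp map_f.
  by rewrite map_take xs xs' take_mkseq.
have snth k k' i : i < (p k).1 -> i < (p k').1 ->
    nth (0, false) (s k) i = nth (0, false) (s k') i.
  wlog kk' : k k' / k <= k' => [h ik ik'|ik _].
    by have [kk'|/ltnW kk'] := leqP k k'; [exact: h | apply/esym/h].
  by rewrite -(ss k k') // nth_take.
have [l lP] := boolp.choice fusion_unbounded.
pose b : branch := fun i => nth (0, false) (s (l i.+1)) i.
have bs n : mkseq b n = take n (s (l n)).
  have sz := approximation_size (pE _) (sP (l n)).1.
  apply: (@eq_from_nth _ (0, false)) => [|i]; rewrite size_mkseq.
    by rewrite size_takel // sz.
  move=> ni; rewrite nth_mkseq // nth_take //; apply: snth => //.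
  exact: leq_trans (lP n).
exists b.
  move=> n; rewrite bs; have [_ pb _] := pE (l n).
  by have [c Ec <-] := pb _ (sP (l n)).1; rewrite take_mkseq //; exact: ET Ec n.
apply: funext => i; rewrite /proj2nd /b.
have [sk xs] := sP (l i.+1); have sz := approximation_size (pE _) sk.
by rewrite -(nth_map _ false) ?sz // xs nth_mkseq.
Qed.

Lemma fusion_bound (z : set nat) k e : splits_at z e -> refines (p k) e ->
  exists2 m, z m & fusion p `<=` [set x | x m].
Proof.
move=> [m [zm me msplit]] [ek pe]; exists m => // x /(fusion_leaf k)[s sk xs] /=.
have mk : m < (p k).1 by exact: leq_trans ek.
have se : take e.1 s \in e.2 by rewrite pe map_f.
have [+ _] := msplit _ se; rewrite nth_take // -(nth_map _ false).
  by rewrite xs nth_mkseq.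
by rewrite (approximation_size (pE k) sk).
Qed.

End Fusion.

Lemma perfect_meeting (hMA : MA_countable) (U : set_system nat)
    (Z : set (set nat)) (T : set node) :
  ProperFilter U -> Z `<=` U -> below_continuum Z ->
  (forall N, Z [set m | N <= m]) ->
  ~ countable (projection T `&` to_cantor U) ->
  exists x : set nat, (forall z, Z z -> x `&` z !=set0) /\
    exists K : set cantor_space, [/\ K !=set0, perfect_set K, K `<=` projection T &
      forall y, K y -> x `<=` [set n | y n]].
Proof.
move=> PU ZU Zsm Ztail nc.
pose B := [set b : branch | (forall n, T (mkseq b n)) /\ to_cantor U (proj2nd b)].
have [|E [EB E0 Ecr]] := @crowded_kernel B.
  apply: contra_not nc; apply: sub_countable; apply: subset_card_le.
  by move=> _ [[b Tb <-] Ub]; exists b.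
have Utail N : U [set m | N <= m] by exact: ZU.
have [|p [pE pdec pZ]] := approximation_chain hMA PU ZU Zsm Utail E0 _ Ecr.
  by move=> b /EB[].
have pF : fusion_sequence E p by split=> // N; exact: pZ (Ztail N).
exists [set m | fusion p `<=` [set x | x m]]; split=> [z /pZ[k [e [_ ez ke]]]|].
  by have [m zm pm] := fusion_bound pF ez ke; exists m.
exists (fusion p); split.
- exact: fusion_nonempty pF.
- exact: perfect_fusion pF.
- by apply: (fusion_sub_projection pF) => b /EB[].
- by move=> y yK m; apply.
Qed.

(** * Analytic sets as projections of trees *)

Lemma separable_sequence (R : realType) (Y : metricType R) (y0 : Y) : separable Y ->
  exists s : nat -> Y, forall (y : Y) (e : R), (0 < e)%R -> exists n, ball (s n) e y.
Proof.
move=> [S /countable_injP[g ginj] Sd].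
have /boolp.choice[s sP] : forall n, exists x, forall y, S y -> g y = n -> y = x.
  move=> n; have [[x [Sx gx]]|nS] := pselect (exists x, S x /\ g x = n).
    by exists x => y Sy gy; apply: ginj; rewrite ?inE // gy.
  by exists y0 => y Sy gy; case: nS; exists y.
exists s => y e e0; have [x [xy Sx]] : (ball y e)^° `&` S !=set0.
  apply: Sd; last exact: open_interior.
  by exists y; exact: nbhsx_ballx.
by exists (g x); rewrite -(sP _ x Sx erefl); apply: ball_sym; exact: interior_subset.
Qed.

(** Let s enumerate a dense sequence of the Polish space.  A point y is coded by
    a sequence g such that y is within 1 / (i + 1) of s (g i) for all i, and the
    tree consists of the finite pieces of pairs (g, f y).  Along any branch the
    witnesses form a Cauchy sequence, whose limit is mapped to the projection of
    the branch. *)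
Lemma analytic_projection (R : realType) (A : set cantor_space) :
  analytic R A -> exists T : set node, A = projection T.
Proof.
move=> [Y [f [Ycpl Ysep fcts <-]]].
have [[y0 _]|Y0] := pselect (exists y : Y, True); last first.
  exists set0; apply/seteqP; split=> [x [y _ _]|x [b /(_ 0) []]].
  by case: Y0; exists y.
have [s sP] := separable_sequence y0 Ysep.
exists [set u : node | exists y : Y, forall i, i < size u ->
  ball (s (nth (0, false) u i).1) (i.+1%:R^-1 : R)%R y /\
  (nth (0, false) u i).2 = f y i].
apply/seteqP; split=> [_ [y _ <-]|_ [b bT <-]].
  have /boolp.choice[g gP] : forall i, exists n, ball (s n) (i.+1%:R^-1 : R)%R y.
    by move=> i; apply: sP; rewrite invr_gt0 ltr0n.
  exists (fun i => (g i, f y i)) => // n; exists y => i; rewrite size_mkseq => ni.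
  by rewrite nth_mkseq //; split=> //; exact: gP.
have /boolp.choice[y yP] : forall n, exists y : Y, forall i, i < n ->
    ball (s (b i).1) (i.+1%:R^-1 : R)%R y /\ (b i).2 = f y i.
  move=> n; have [y yP] := bT n; exists y => i ni.
  by have := yP i; rewrite size_mkseq nth_mkseq //; apply.
have [l yl] : exists l : Y, y n @[n --> \oo] --> l.
  apply: Ycpl; apply: cauchy_exP => e e0.
  have [i] := ltr_add_invr e0; rewrite add0r => ie.
  exists (s (b i).1); exists i.+1 => // n /= ni.
  by apply: le_ball (ltW ie) _ _; have [] := yP n i ni.
exists l => //; apply: funext => i.
have : nbhs l [set z | mkseq (f z) i.+1 = mkseq (f l) i.+1].
  exact: fcts (cylinder_nbhs (f l) i.+1).
move=> /yl[n _ /(_ (maxn n i.+1) (leq_maxl _ _)) /mkseq_eqP/(_ i (leqnn _)) <-].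
by have [|_ <-] := yP (maxn n i.+1) i; rewrite ?leq_maxr.
Qed.

(** * A well-order with few finite sequences in each initial segment *)

(** Cantor's diagonal argument. *)
Lemma below_continuum_countable T (A : set T) : countable A -> below_continuum A.
Proof.
move=> Ac /card_le_trans/(_ Ac)/(card_le_injP 0)[f _ finj].
pose x : cantor_space := fun n => `[< exists y : cantor_space, f y = n /\ y n = false >].
have xE n : x n = true <-> exists y : cantor_space, f y = n /\ y n = false.
  by split=> [/asboolP//|h]; apply/asboolP.
have [xf|xf] : x (f x) = true \/ x (f x) = false by case: (x (f x)); [left|right].
  have [y [fyx]] := (xE _).1 xf.
  by rewrite (finj _ _ _ _ fyx) ?inE // xf.
have : x (f x) = true by apply/xE; exists x.
by rewrite xf.
Qed.

Definition strict_well_order T (lt : T -> T -> Prop) : Prop :=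
  [/\ forall A : set T, A !=set0 -> exists2 m, A m & forall a, A a -> ~ lt a m,
      forall x y z, lt x y -> lt y z -> lt x z &
      forall x y, [\/ x = y, lt x y | lt y x]].

Lemma strict_well_orderP T (lt : T -> T -> Prop) :
  strict_well_order lt -> well_founded lt.
Proof.
move=> [ltmin _ _] x; apply: contrapT => nx.
have [|m nm mmin] := ltmin [set y | ~ Acc lt y]; first by exists x.
apply: nm; constructor => y ym; apply: contrapT => ny; exact: mmin ny ym.
Qed.

Lemma strict_well_order_exists (T : eqType) : exists lt : T -> T -> Prop, strict_well_order lt.
Proof.
have [R Rwo] := wochoice.well_ordering_principle T.
have Rmin (A : set T) : A !=set0 -> exists2 m, A m & forall a, A a -> R m a.
  move=> [a Aa]; have [|m [[mA mlb] _]] := Rwo (fun x => `[< A x >]).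
    by exists a; apply/asboolP.
  exists m => [|b Ab]; first exact/asboolP.
  by apply: mlb; apply/asboolP.
have Rxx x : R x x by have [|m -> ] := Rmin [set x]; [exists x | apply].
have Ranti x y : R x y -> R y x -> x = y.
  move=> xy yx; have [|m [_ mu]] := Rwo (pred2 x y); first by exists x; rewrite !inE eqxx.
  rewrite -(mu x) ?(mu y) //; split; rewrite ?inE ?eqxx ?orbT // => z;
  by rewrite !inE => /orP[] /eqP->.
have Rtot x y : R x y \/ R y x.
  have [|m [->|->] mlb] := Rmin [set z | z = x \/ z = y]; first by exists x; left.
    by left; apply: mlb; right.
  by right; apply: mlb; left.
have Rtr x y z : R x y -> R y z -> R x z.
  move=> xy yz; have [|m mE mlb] := Rmin [set t | [\/ t = x, t = y | t = z]].
    by exists x; exact: Or31.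
  have mx : R m x by apply: mlb; exact: Or31.
  have my : R m y by apply: mlb; exact: Or32.
  have mz : R m z by apply: mlb; exact: Or33.
  by case: mE => e; subst m => //; [rewrite (Ranti _ _ xy mx) | rewrite -(Ranti _ _ yz my)].
exists (fun x y => R x y /\ x <> y); split.
- move=> A /Rmin[m Am mlb]; exists m => // a Aa [am]; apply; exact: Ranti am (mlb _ Aa).
- move=> x y z [xy nxy] [yz nyz]; split; first exact: Rtr yz.
  by move=> xz; subst z; apply: nxy; exact: Ranti.
- move=> x y; have [->|xy] := eqVneq x y; first exact: Or31.
  have [h|h] := Rtot x y; [apply: Or32|apply: Or33]; split=> //; first exact/eqP.
  by apply/eqP; rewrite eq_sym.
Qed.

(** The factor nat makes room for coding the shape of a word, so that words of
    words are again words. *)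
Definition words (T : eqType) (W : set T) : set (seq T * nat) :=
  [set p | forall i, i \in p.1 -> W i].

Definition upto T (lt : T -> T -> Prop) (i : T) : set T := [set j | j = i \/ lt j i].

(** Delete i from the word and record its positions in the natural number. *)
Lemma words_add1 (T : eqType) (V W : set T) i :
  V `<=` [set j | j = i \/ W j] -> (words V #<= words W)%card.
Proof.
move=> VW.
apply: (@card_le_inj _ _ _ _ (fun p : seq T * nat =>
  ([seq j <- p.1 | j != i], pickle (p.2, [seq j == i | j <- p.1])))) => [p pV j|].
  by rewrite mem_filter /= => /andP[ji /pV/VW[/eqP|//]]; rewrite (negbTE ji).
move=> [s n] [t m] _ _ /= [st /(pcan_inj pickleK)[-> mst]]; congr pair.
elim: s t st mst => [|a s IH] [|b t] //= st [ab mst].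
move: st; rewrite ab; have [be|be] /= := eqVneq b i => [|[-> st]].
  by move: ab; rewrite be eqxx => /eqP-> /IH -> .
by rewrite (IH t).
Qed.

(** Flatten the word of words and record its shape in the natural number. *)
Lemma words_words (T : eqType) (X W : set T) (e : T -> seq T * nat) :
  injective e -> (forall i, X i -> words W (e i)) -> (words X #<= words W)%card.
Proof.
move=> einj eW.
pose f (p : seq T * nat) := (flatten [seq (e i).1 | i <- p.1],
  pickle (p.2, (shape [seq (e i).1 | i <- p.1], [seq (e i).2 | i <- p.1]))).
apply: (@card_le_inj _ _ _ _ f) => [p pX j /flatten_mapP[i ip ji]|].
  exact: eW (pX _ ip) _ ji.
move=> [s n] [t m] _ _ /= [fst' /(pcan_inj pickleK)[-> sst nst]]; congr pair.
have {fst' sst}e1 : [seq (e i).1 | i <- s] = [seq (e i).1 | i <- t].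
  by rewrite -[LHS]flattenK sst fst' flattenK.
elim: s t nst e1 => [|a s IH] [|b t] //= [ab2 st2] [ab1 st1].
rewrite (IH t) //; congr cons; apply: einj.
by rewrite [LHS]surjective_pairing ab1 ab2 -surjective_pairing.
Qed.

Lemma upto_max (T : eqType) (lt : T -> T -> Prop) (s : seq T) : strict_well_order lt ->
  0 < size s -> exists2 i, i \in s & forall j, j \in s -> upto lt i j.
Proof.
move=> [_ lttr lttot]; elim: s => //= a [|b s] IH _.
  by exists a => [|j]; rewrite inE // => /eqP->; left.
have [//|i ins iM] := IH; have [ai|ai|ia] := lttot a i.
- by exists i => [|j]; rewrite inE ?ins ?orbT // => /orP[/eqP->|/iM//]; left.
- by exists i => [|j]; rewrite inE ?ins ?orbT // => /orP[/eqP->|/iM//]; right.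
- exists a => [|j]; rewrite inE ?eqxx // => /orP[/eqP->|/iM[->|ji]]; [by left|by right|].
  by right; exact: lttr ia.
Qed.

(** Start from any well-order lt and cut it at the first point whose initial
    segment has c many words, if there is one.  Then each point i of the whole
    set is coded by a word e i over the remaining part, every initial segment of
    which has fewer than c words.  Compare points by the largest letter rho i of
    their codes first (the least point if the code is empty), and by lt second: all codes of predecessors of i are words
    over the initial segment up to rho i, so that words in these predecessors
    are words of words over that segment. *)
Lemma short_well_order : exists lt : cantor_space -> cantor_space -> Prop,
  strict_well_order lt /\ forall i, below_continuum (words [set j | lt j i]).
Proof.
have [lt ltwo] := strict_well_order_exists cantor_space.
have [ltmin lttr lttot] := ltwo.
pose small i := below_continuum (words (upto lt i)).
have [e einj esmall] : exists2 e : cantor_space -> seq cantor_space * nat, injective e &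
    forall i k, k \in (e i).1 -> small k.
  have [allsmall|] := pselect (forall i, small i).
    by exists (fun i => ([:: i], 0)) => // i j [].
  move=> /existsNP[i0 /= ni0]; have [|i /= ni imin] := ltmin [set i | ~ small i].
    by exists i0.
  have : ([set: cantor_space] #<= words [set k | lt k i])%card.
    apply: card_le_trans (contrapT ni) _; exact: (@words_add1 _ _ _ i).
  move=> /(card_le_injP ([::], 0))[e eW einj]; exists e => [j k /einj|j k kj].
    by apply; rewrite inE.
  by apply: contrapT => /imin; apply; exact: (eW j I).
have /boolp.choice[rho rhoP] : forall i, exists r, small r /\
    forall k, k \in (e i).1 -> upto lt r k.
  move=> i; have [e0|] := posnP (size (e i).1); last first.
    by move=> /(upto_max ltwo)[r re rM]; exists r; split=> //; exact: esmall re.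
  have [|b _ bmin] := ltmin [set: cantor_space]; first by exists point.
  exists b; split=> [|k]; last by rewrite (size0nil e0).
  apply: (@below_continuum_le _ _ _ (words set0)).
    apply: (@words_add1 _ _ _ b) => j [->|jb]; first by left.
    by case: (bmin j).
  apply: below_continuum_countable; apply/countable_injP.
  exists snd => -[[|k s] n] [[|l t] m] /set_mem /= h1 /set_mem /= h2 //=.
  - by move=> ->.
  - by case: (h2 l); rewrite /= mem_head.
  - by case: (h1 k); rewrite /= mem_head.
  - by case: (h1 k); rewrite /= mem_head.
exists (fun i j => lt (rho i) (rho j) \/ (rho i = rho j /\ lt i j)); split; last first.
  move=> i; apply: below_continuum_le (rhoP i).1; apply: words_words einj _ => j ji k kj.
  have ri : upto lt (rho i) (rho j) by case: ji => [|[->]]; [right|left].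
  have kr := (rhoP j).2 _ kj.
  by case: ri kr => [->//|rji] [->|kr]; right => //; exact: lttr rji.
split=> [A [a Aa]|x y z|x y].
- have [|_ [b Ab <-] rmin] := ltmin (rho @` A); first by exists (rho a), a.
  have [|m [Am mb] mmin] := ltmin [set c | A c /\ rho c = rho b]; first by exists b.
  exists m => // c Ac [cm|[cm cltm]].
    by apply: (rmin (rho c)); [exists c | rewrite -mb].
  by apply: mmin cltm; split; rewrite // cm.
- move=> [xy|[xy ltxy]] [yz|[yz ltyz]].
  + by left; exact: lttr yz.
  + by left; rewrite -yz.
  + by left; rewrite xy.
  + by right; rewrite xy yz; split=> //; exact: lttr ltyz.
- have [rxy|rxy|ryx] := lttot (rho x) (rho y).
  + have [->|xy|yx] := lttot x y; first exact: Or31.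
      by apply: Or32; right.
    by apply: Or33; right.
  + by apply: Or32; left.
  + by apply: Or33; left.
Qed.

(** * The recursion *)

Lemma well_founded_recursion (I A : Type) (lt : I -> I -> Prop) (a0 : A)
    (G : I -> (I -> A) -> A) : well_founded lt ->
  (forall i x y, (forall j, lt j i -> x j = y j) -> G i x = G i y) ->
  exists x : I -> A, forall i, x i = G i x.
Proof.
move=> ltwf Gloc.
pose ext i (r : forall j, lt j i -> A) (j : I) : A :=
  if pselect (lt j i) is left ji then r j ji else a0.
pose F i (r : forall j, lt j i -> A) := G i (ext i r).
exists (Fix ltwf (fun=> A) F) => i.
rewrite Fix_eq => [|j f g fg].
  apply: Gloc => j ji; rewrite /ext; by case: pselect.
by rewrite /F; apply: Gloc => k kj; rewrite /ext; case: pselect.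
Qed.

(** The transfinite recursion, for arbitrary requests Q t.  For each t the filter
    U grants Q t as soon as some c grants it that meets all sets of the small
    family Z, the filter base available at the stage of t.  In applications Z is
    known only to be contained in U, which suffices. *)
Lemma task_filter (task : Type) (Q : task -> set nat -> Prop) :
  ([set: task] #<= [set: cantor_space])%card ->
  exists U : set_system nat,
    [/\ ProperFilter U, forall N, U [set m | N <= m] &
     forall t, exists Z : set (set nat),
       [/\ Z `<=` U, below_continuum Z, forall N, Z [set m | N <= m] &
        (exists c, (forall z, Z z -> c `&` z !=set0) /\ Q t c) ->
        exists2 c, U c & Q t c]].
Proof.
move=> /(card_le_injP (point : cantor_space))[code _ codeinj].
have [lt [ltwo ltsmall]] := short_well_order.
pose meet (x : cantor_space -> set nat) (p : seq cantor_space * nat) : set nat :=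
  [set m | p.2 <= m /\ forall j, j \in p.1 -> x j m].
pose cand i x c := (forall p, words [set j | lt j i] p -> c `&` meet x p !=set0) /\
  exists2 t, code t = i & Q t c.
have [|x xE] := @well_founded_recursion _ _ _ point (fun i x => xget setT (cand i x))
  (strict_well_orderP ltwo).
  move=> i x y xy; congr xget; apply: funext => c; rewrite /cand.
  suff e p : words [set j | lt j i] p -> meet x p = meet y p.
    by congr and; apply: eq_forall => p; apply: propext; split=> h ip;
      [rewrite -e|rewrite e] => //; exact: h.
  move=> ip; apply: funext => m; rewrite /meet /=; congr and; apply: eq_forall => j.
  by apply: propext; split=> h jp; [rewrite -xy|rewrite xy]; try exact: h; exact: ip.
have xcand i c : cand i x c -> cand i x (x i).
  by move=> ic; rewrite xE; exact: (@xgetI _ _ _ c).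
have xT i : ~ (exists c, cand i x c) -> x i = setT.
  by move=> nc; rewrite xE xgetPN // => c ic; apply: nc; exists c.
(* If nothing was added at stage i, then x i = setT imposes no condition and
   the claim reduces to the largest remaining index. *)
have meet_upto i : forall p, words (upto lt i) p -> meet x p !=set0.
  elim/(well_founded_ind (strict_well_orderP ltwo)): i => i IH p pi.
  pose q := ([seq j <- p.1 | j != i], p.2).
  have qi : words [set j | lt j i] q.
    by move=> j; rewrite mem_filter => /andP[/eqP ji /pi[]].
  have [[c ic]|nc] := pselect (exists c, cand i x c).
    have [/(_ _ qi)[m [xm [pm qm]]] _] := xcand _ _ ic.
    exists m; split=> // j jp; have [->//|ji] := eqVneq j i.
    by apply: qm; rewrite mem_filter ji.
  have [m [pm qm]] : meet x q !=set0.
    have [q0|] := posnP (size q.1).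
      by exists p.2; split=> // j; rewrite (size0nil q0).
    move=> /(upto_max ltwo)[k kq kM]; apply: (IH k); first exact: qi kq.
    by move=> j /kM.
  exists m; split=> // j jp; have [->|ji] := eqVneq j i; first by rewrite xT.
  by apply: qm; rewrite mem_filter ji.
have meet_ex p : meet x p !=set0.
  have [p0|/(upto_max ltwo)[k kp kM]] := posnP (size p.1).
    by exists p.2; split=> // j; rewrite (size0nil p0).
  exact: meet_upto kM.
pose U : set_system nat := [set y | exists p, meet x p `<=` y].
have UI : Filter U.
  split; first by exists ([::], 0).
    move=> y z [p py] [q qz]; exists (p.1 ++ q.1, maxn p.2 q.2) => m [].
    rewrite geq_max => /andP[pm qm] pqm; split.
      by apply: py; split=> // j jp; apply: pqm; rewrite mem_cat jp.
    by apply: qz; split=> // j jq; apply: pqm; rewrite mem_cat jq orbT.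
  by move=> y z yz [p py]; exists p => m /py/yz.
have tail N : meet x ([::], N) = [set m | N <= m].
  by apply/seteqP; split=> m //= [].
exists U; split.
- by split=> // -[p p0]; have [m /p0] := meet_ex p.
- by move=> N; exists ([::], N); rewrite tail.
move=> t; exists (meet x @` words [set j | lt j (code t)]); split.
- by move=> _ [p _ <-]; exists p.
- exact: below_continuum_le (card_image_le _ _) (ltsmall _).
- by move=> N; exists ([::], N) => //; exact: tail.
move=> [c [cZ Qc]].
have [|_ [t' tt' Qt']] := xcand (code t) c.
  by split=> [p pt|]; [apply: cZ; exists p | exists t].
exists (x (code t)); first by exists ([:: code t], 0) => m [_]; apply; rewrite mem_head.
by rewrite (codeinj t' t) ?inE // in Qt'.
Qed.

Definition task : Type := (nat -> set nat) + set node.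

Definition fulfils (t : task) (c : set nat) : Prop :=
  match t with
  | inl C => pseudointersection (range C) c
  | inr T => exists K : set cantor_space,
      [/\ K !=set0, perfect_set K, K `<=` projection T &
          forall y, K y -> c `<=` [set n | y n]]
  end.

Lemma card_task : ([set: task] #<= [set: cantor_space])%card.
Proof.
(* The index None tells the two kinds of tasks apart. *)
pose f (t : task) (k : option (nat * nat + node)) : Prop :=
  match t, k with
  | inl C, Some (inl (n, m)) => C n m
  | inr T, Some (inr s) => T s
  | inr _, None => True
  | _, _ => False
  end.
apply: (@card_le_cantor_countType _ _ f) => -[C|T] [C'|T'] ff;
  have {}ff k := congr1 (fun h => h k) ff.
- by congr inl; apply: funext => n; apply: funext => m; exact: (ff (Some (inl (n, m)))).
- by have /= := ff None; move=> e; suff : False by []; rewrite e.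
- by have /= := ff None; move=> e; suff : False by []; rewrite -e.
- by congr inr; apply: funext => s; exact: (ff (Some (inr s))).
Qed.

(** * The P-point *)

Theorem theorem46 (R : realType) (hMA : MA_countable) :
  exists U : set_system nat,
    P_point U /\
    forall A : set cantor_space, analytic R A ->
      perfect_set_property (A `&` to_cantor U).
Proof.
have [U [PU Utail Utask]] := task_filter fulfils card_task.
have Udec y : U y \/ U (~` y).
  have [Z [ZU _ _ Zt]] := Utask (inl (fun=> y)).
  have [ymeet|] := pselect (forall z, Z z -> y `&` z !=set0).
    left; have [|c Uc cy] := Zt.
      by exists y; split=> // _ [_ _ <-]; rewrite /almost_subset setDv; exact: finite_set0.
    have /finite_seqP[s cs] : almost_subset c y by apply: cy; exists 0.
    apply: filterS (filterI Uc (Utail (\max_(i <- s) i).+1)) => m [cm sm].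
    apply: contrapT => ym; have ms : m \in s by have : (c `\` y) m by []; rewrite cs.
    by move: sm => /=; rewrite ltnNge (@leq_bigmax_seq _ s xpredT id).
  move=> /existsNP[z /not_implyP[Zz yz]]; right.
  by apply: filterS (ZU _ Zz) => m zm ym; apply: yz; exists m.
exists U; split.
  split.
  - split=> // G PG UG; apply/seteqP; split=> // y Gy; have [//|/UG Gny] := Udec y.
    by have [m []] := filter_ex (filterI Gy Gny).
  - move=> n Un; have : U [set n] by rewrite Un.
    move=> /filterI - /(_ _ (Utail n.+1)) /filter_ex[m [/= ->]].
    by rewrite ltnn.
  - move=> C Cc CU.
    have /(card_le_injP 0)[f _ finj] := Cc.
    have /boolp.choice[y yP] : forall n, exists y, U y /\ forall z, C z -> f z = n -> z = y.
      move=> n; have [[z [Cz zn]]|nz] := pselect (exists z, C z /\ f z = n).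
        exists z; split=> [|z' Cz' z'n]; first exact: CU.
        by apply: finj; rewrite ?inE // zn.
      exists setT; split=> [|z Cz zn]; first exact: filterT.
      by case: nz; exists z.
    have [Z [ZU Zsm Ztail Zt]] := Utask (inl y).
    have [|x [xZ xy]] := @pseudointersection_meeting hMA U Z y PU ZU Zsm Ztail.
      by move=> n; have [] := yP n.
    have [|c Uc cy] := Zt; first by exists x; split=> // _ [n _ <-].
    exists c => // z Cz; apply: cy; exists (f z) => //.
    by have [_ /(_ z Cz erefl)] := yP (f z).
move=> A /analytic_projection[T ->].
have [c|nc] := pselect (countable (projection T `&` to_cantor U)); first by left.
right; have [Z [ZU Zsm Ztail Zt]] := Utask (inr T).
have [x [xZ xQ]] := perfect_meeting hMA PU ZU Zsm Ztail nc.
have [|c Uc [K [K0 Kp KT cK]]] := Zt; first by exists x.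
exists K; split=> // y Ky; split; first exact: KT.
exact: filterS (cK _ Ky) Uc.
Qed.
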